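(* Let $\Sigma$ be a real symmetric positive definite $2\times 2$ matrix, $\mu\in\mathbb{R}^2$, and let $R=(r_{ij})$ be a real $2\times 2$ matrix such that $$r_{11}>0,\quad r_{22}>0,\quad r_{11}r_{22}-r_{12}r_{21}>0,\qquad r_{22}\mu_1-r_{12}\mu_2<0,\quad r_{11}\mu_2-r_{21}\mu_1<0 .$$ With the notation of the context, the exit velocities $\tilde a^1$ and $\tilde a^2$ satisfy $$\tilde a^{1}=\mathrm n^\Gamma(\tilde\theta^{(2,\mathrm r)})\qquad\text{and}\qquad \tilde a^{2}=\mathrm n^\Gamma(\tilde\theta^{(1,\mathrm r)}).$$
   Context: Notation: $\langle\cdot,\cdot\rangle$ is the Euclidean inner product; $R^1,R^2$ are the columns of $R$; $\mathrm e^{(1)}=(1,0)^T$, $\mathrm e^{(2)}=(0,1)^T$. Geometric objects: $\gamma(\theta)=-\frac12\langle\theta,\Sigma\theta\rangle-\langle\mu,\theta\rangle$, $\gamma_i(\theta)=\langle R^i,\theta\rangle$, $i=1,2$; $\partial\Gamma=\{\theta\in\mathbb{R}^2:\gamma(\theta)=0\}$ is an ellipse through the origin. $\theta^{(i,\max)}$ is the unique maximizer of $\theta_i$ over $\partial\Gamma$. $\theta^{(i,\mathrm r)}$ is the unique nonzero point of $\partial\Gamma$ with $\gamma_{3-i}(\theta)=0$. $\tilde\theta^{(i,\mathrm r)}=\theta^{(i,\max)}$ if $\theta^{(i,\mathrm r)}=\theta^{(i,\max)}$; otherwise $\tilde\theta^{(i,\mathrm r)}$ is the unique point of $\partial\Gamma$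 with the same $i$-th coordinate as $\theta^{(i,\mathrm r)}$ and a different $(3-i)$-th coordinate. $\mathrm n^\Gamma(\theta)=\Sigma\theta+\mu$. Exit velocities: for $i=1,2$ let $a^{i}=\mathrm n^\Gamma(\theta^{(3-i,\mathrm r)})$, $\mathrm e^{i}=\mathrm e^{(3-i)}$, $\mathrm n^{i}=\mathrm e^{(i)}$. The symmetry $\tilde a^i$ of $a^i$ around the face $F_i=\{x\in\mathbb{R}^2_+:x_i=0\}$ is $$\tilde a^{i}=\frac{\langle\Sigma^{-1}a^{i},\mathrm e^{i}\rangle}{\langle\Sigma^{-1}\mathrm e^{i},\mathrm e^{i}\rangle}\,\mathrm e^{i}-\frac{\langle a^{i},\mathrm n^{i}\rangle}{\langle\Sigma \mathrm n^{i},\mathrm n^{i}\rangle}\,\Sigma \mathrm n^{i}.$$ *)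

(* Defs.v *)
From HB Require Import structures.
From mathcomp Require Import all_boot all_order all_algebra.
From mathcomp Require Import classical_sets reals.

Set Implicit Arguments.
Unset Strict Implicit.
Unset Printing Implicit Defensive.

Import Order.TTheory GRing.Theory Num.Theory.
Local Open Scope classical_set_scope.
Local Open Scope ring_scope.

(* The indices 1, 2 are 0, 1 : 'I_2; the complementary index 3 - i is
   rev_ord i.  Vectors of the plane are column vectors. *)

Definition dot (K : realType) (x y : 'cV[K]_2) : K :=
  \sum_i x i 0 * y i 0.

Definition sym_posdef (K : realType) (Sigma : 'M[K]_2) : Prop :=
  Sigma^T = Sigma /\ forall x : 'cV[K]_2, x != 0 -> 0 < dot x (Sigma *m x).

Definition evec (K : realType) (i : 'I_2) : 'cV[K]_2 := delta_mx i 0.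
Arguments evec K i : clear implicits.

Definition gamma (K : realType) (Sigma : 'M[K]_2) (mu theta : 'cV[K]_2) : K :=
  - (2^-1 * dot theta (Sigma *m theta)) - dot mu theta.

Definition gammai (K : realType) (R : 'M[K]_2) (i : 'I_2) (theta : 'cV[K]_2)
  : K := dot (col i R) theta.

Definition bdGamma (K : realType) (Sigma : 'M[K]_2) (mu : 'cV[K]_2)
  : set 'cV[K]_2 := [set theta | gamma Sigma mu theta = 0].

(* "The unique point such that ..." is rendered by [xget 0], which picks an
   element of a nonempty set and returns 0 on the empty set.  Under the
   hypotheses on Sigma, mu, R of the theorem, every set to which it is applied
   below is a singleton (for [theta_tilde], in the branch where it is used). *)

Definition theta_max (K : realType) (Sigma : 'M[K]_2) (mu : 'cV[K]_2)
    (i : 'I_2) : 'cV[K]_2 :=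
  xget 0 [set theta | bdGamma Sigma mu theta /\
    forall eta, bdGamma Sigma mu eta -> eta i 0 <= theta i 0].

Definition theta_r (K : realType) (Sigma : 'M[K]_2) (mu : 'cV[K]_2)
    (R : 'M[K]_2) (i : 'I_2) : 'cV[K]_2 :=
  xget 0 [set theta | [/\ bdGamma Sigma mu theta, theta != 0 &
    gammai R (rev_ord i) theta = 0]].

Definition theta_tilde (K : realType) (Sigma : 'M[K]_2) (mu : 'cV[K]_2)
    (R : 'M[K]_2) (i : 'I_2) : 'cV[K]_2 :=
  let tr := theta_r Sigma mu R i in
  let tmax := theta_max Sigma mu i in
  if tr == tmax then tmax
  else xget 0 [set theta | [/\ bdGamma Sigma mu theta,
    theta i 0 = tr i 0 & theta (rev_ord i) 0 != tr (rev_ord i) 0]].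

Definition nGamma (K : realType) (Sigma : 'M[K]_2) (mu theta : 'cV[K]_2)
  : 'cV[K]_2 := Sigma *m theta + mu.

Definition exit_velocity (K : realType) (Sigma : 'M[K]_2) (mu : 'cV[K]_2)
    (R : 'M[K]_2) (i : 'I_2) : 'cV[K]_2 :=
  nGamma Sigma mu (theta_r Sigma mu R (rev_ord i)).

(* The symmetry of a around the face x_i = 0, whose direction is
   e = evec (rev_ord i) and whose inward normal is n = evec i. *)
Definition face_symmetry (K : realType) (Sigma : 'M[K]_2) (i : 'I_2)
    (a : 'cV[K]_2) : 'cV[K]_2 :=
  let e := evec K (rev_ord i) in
  let n := evec K i in
  (dot (invmx Sigma *m a) e / dot (invmx Sigma *m e) e) *: e
  - (dot a n / dot (Sigma *m n) n) *: (Sigma *m n).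

Definition exit_velocity_tilde (K : realType) (Sigma : 'M[K]_2)
    (mu : 'cV[K]_2) (R : 'M[K]_2) (i : 'I_2) : 'cV[K]_2 :=
  face_symmetry Sigma i (exit_velocity Sigma mu R i).

(* Main.v *)
Require Import Defs.
From HB Require Import structures.
From mathcomp Require Import all_boot all_order all_algebra.
From mathcomp Require Import classical_sets reals.
From mathcomp Require Import ring lra.

Import Order.TTheory GRing.Theory Num.Theory.
Local Open Scope ring_scope.

(* Write i for the index and j for the other one.  The symmetry around the
   face F_j sends a to a - 2 (a_j / Sigma_jj) Sigma e_j, hence sends the normal
   n(theta) to n(theta') with theta' = theta - 2 (a_j / Sigma_jj) e_j; and
   theta' is exactly the second intersection of the ellipse with the line
   through theta on which the i-th coordinate is constant.  The two points
   coincide iff a_j = 0, i.e. iff theta maximizes or minimizes theta_i on the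
   ellipse.  The minimum is excluded for theta^(i,r): there theta_i > 0 by the
   conditions on R and mu, and <a, theta> = <theta, Sigma theta> / 2 > 0. *)

(** * Plane coordinates relative to an index and its complement *)

Lemma rev_ord2_neq (i : 'I_2) : rev_ord i != i.
Proof. by case: i => [[|[|]]]. Qed.

Lemma big_ord2 (V : nmodType) (i : 'I_2) (F : 'I_2 -> V) :
  \sum_k F k = F i + F (rev_ord i).
Proof.
rewrite (bigD1 i) //= (bigD1 (rev_ord i)) ?rev_ord2_neq //= big1 ?addr0 //.
by case: i => [[|[|]]] // ?; case=> [[|[|]]].
Qed.

Lemma cV2_ext (K : pzRingType) (i : 'I_2) (x y : 'cV[K]_2) :
  x i 0 = y i 0 -> x (rev_ord i) 0 = y (rev_ord i) 0 -> x = y.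
Proof.
move=> ei ej; apply/colP => k; have [->//|/negPf ki] := eqVneq k i.
suff -> : k = rev_ord i by [].
apply/val_inj; move: ki; rewrite -val_eqE /=.
by case: i k {ei ej} => [[|[|]]] // ? [[|[|]]].
Qed.

Lemma evec_self (K : realType) (i : 'I_2) : evec K i i 0 = 1.
Proof. by rewrite mxE !eqxx. Qed.

Lemma evec_rev (K : realType) (i : 'I_2) : evec K (rev_ord i) i 0 = 0.
Proof. by rewrite mxE eq_sym (negPf (rev_ord2_neq i)). Qed.

Lemma evec_rev' (K : realType) (i : 'I_2) : evec K i (rev_ord i) 0 = 0.
Proof. by rewrite mxE (negPf (rev_ord2_neq i)). Qed.

Lemma evec_comb (K : realType) (i : 'I_2) (a b : K) :
  (a *: evec K i + b *: evec K (rev_ord i)) i 0 = a.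
Proof.
by rewrite mxE [X in X + _]mxE [X in _ + X]mxE evec_self evec_rev; ring.
Qed.

Lemma evec_comb_rev (K : realType) (i : 'I_2) (a b : K) :
  (a *: evec K i + b *: evec K (rev_ord i)) (rev_ord i) 0 = b.
Proof.
by rewrite mxE [X in X + _]mxE [X in _ + X]mxE evec_self evec_rev'; ring.
Qed.

Lemma dotE (K : realType) (i : 'I_2) (x y : 'cV[K]_2) :
  dot x y = x i 0 * y i 0 + x (rev_ord i) 0 * y (rev_ord i) 0.
Proof. exact: big_ord2. Qed.

Lemma dot_evec (K : realType) (i : 'I_2) (x : 'cV[K]_2) :
  dot x (evec K i) = x i 0.
Proof. by rewrite (dotE _ i) evec_self evec_rev' mulr1 mulr0 addr0. Qed.

Lemma mulmx2E (K : realType) (i k : 'I_2) (A : 'M[K]_2) (x : 'cV[K]_2) :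
  (A *m x) k 0 = A k i * x i 0 + A k (rev_ord i) * x (rev_ord i) 0.
Proof. by rewrite mxE (big_ord2 _ i). Qed.

Lemma mul_evec (K : realType) (i k : 'I_2) (A : 'M[K]_2) :
  (A *m evec K i) k 0 = A k i.
Proof. by rewrite (mulmx2E _ i) evec_self evec_rev' mulr1 mulr0 addr0. Qed.

(** * Symmetric positive definite matrices of size two *)

Lemma sym_entry (K : realType) (S : 'M[K]_2) (i j : 'I_2) :
  sym_posdef S -> S i j = S j i.
Proof. by case=> hT _; rewrite -{1}hT mxE. Qed.

Lemma evec_neq0 (K : realType) (i : 'I_2) : evec K i != 0.
Proof.
by apply/eqP => /matrixP /(_ i 0); rewrite evec_self mxE; apply/eqP/oner_neq0.
Qed.

Lemma posdef_diag (K : realType) (S : 'M[K]_2) (i : 'I_2) :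
  sym_posdef S -> 0 < S i i.
Proof.
case=> _ /(_ _ (evec_neq0 K i)).
by rewrite (dotE _ i) evec_self evec_rev' mul1r mul0r addr0 mul_evec.
Qed.

Lemma quad_form2 (K : realType) (S : 'M[K]_2) (i : 'I_2) (x : 'cV[K]_2) :
  sym_posdef S ->
  dot x (S *m x) = S i i * x i 0 ^+ 2
    + 2 * S i (rev_ord i) * x i 0 * x (rev_ord i) 0
    + S (rev_ord i) (rev_ord i) * x (rev_ord i) 0 ^+ 2.
Proof.
move=> hS; rewrite (dotE _ i) !(mulmx2E _ i) (sym_entry _ _ (rev_ord i) i hS); ring.
Qed.

Lemma posdef_minor (K : realType) (S : 'M[K]_2) (i : 'I_2) :
  sym_posdef S ->
  0 < S i i * S (rev_ord i) (rev_ord i) - S i (rev_ord i) ^+ 2.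
Proof.
move=> hS; set j := rev_ord i.
have C0 := posdef_diag _ _ j hS.
(* This vector is orthogonal to [evec K j] for the form given by [S]; its quadratic form is [S j j]
   times the minor. *)
pose v := S j j *: evec K i + (- S i j) *: evec K j.
have vi : v i 0 = S j j := evec_comb _ _ _ _.
have vj : v j 0 = - S i j := evec_comb_rev _ _ _ _.
have v0 : v != 0.
  by apply/eqP => /matrixP /(_ i 0); rewrite vi mxE => e; rewrite e ltxx in C0.
have := hS.2 _ v0; rewrite (quad_form2 _ _ i _ hS) -/j vi vj.
rewrite (_ : _ + _ = S j j * (S i i * S j j - S i j ^+ 2)); last by ring.
by rewrite pmulr_rgt0.
Qed.

Lemma posdef_unitmx (K : realType) (S : 'M[K]_2) :
  sym_posdef S -> S \in unitmx.
Proof.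
move=> hS; rewrite unitmxE unitfE; apply/negP => /det0P [v v0 vS].
have := hS.2 v^T; rewrite trmx_eq0 => /(_ v0).
by rewrite -{1}hS.1 -trmx_mul vS trmx0 (dotE _ 0)
   ![(0 : 'cV_2) _ _]mxE !mulr0 addr0 ltxx.
Qed.

(** * The symmetry around a face *)

(** With [j] the other index, the symmetry fixes [evec K i] and negates [S *m evec K j]; it suffices
    to expand [a] in this basis. *)
Lemma face_symmetryE (K : realType) (S : 'M[K]_2) (i : 'I_2) (a : 'cV[K]_2) :
  sym_posdef S ->
  face_symmetry S (rev_ord i) a =
  a - (2 * a (rev_ord i) 0 / S (rev_ord i) (rev_ord i))
        *: (S *m evec K (rev_ord i)).
Proof.
move=> hS; rewrite /face_symmetry rev_ordK; set j := rev_ord i.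
have C0 : S j j != 0 by rewrite gt_eqF ?posdef_diag.
have SU := posdef_unitmx _ _ hS.
rewrite !dot_evec (mul_evec _ _ _ S); set b := a j 0 / S j j.
pose al := a i 0 - b * S i j.
have ea : a = al *: evec K i + b *: (S *m evec K j).
  apply: (cV2_ext _ i); rewrite mxE [X in X + _]mxE [X in _ + X]mxE mul_evec.
    by rewrite evec_self /al; ring.
  by rewrite evec_rev' -/j /b; field.
(* With [u] the vector [invmx S *m evec K i], this denominator equals [dot u (S *m u)]. *)
have u0 : (invmx S *m evec K i) i 0 != 0.
  rewrite -dot_evec; set u := invmx S *m _.
  have Su : S *m u = evec K i by rewrite mulKVmx.
  rewrite -Su gt_eqF // hS.2 //; apply/eqP => u0.
  by have := evec_neq0 K i; rewrite -Su u0 mulmx0 eqxx.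
have -> : (invmx S *m a) i 0 = al * (invmx S *m evec K i) i 0.
  rewrite {1}ea mulmxDr -!scalemxAr mulKmx // mxE [X in X + _]mxE.
  by rewrite [X in _ + X]mxE evec_rev mulr0 addr0.
by rewrite mulfK // -mulrA -/b ea mulr_natl mulr2n [(b + b) *: _]scalerDl
   opprD addrA addrK.
Qed.

(** * Chords, normals and maximizers of the ellipse *)

(** Exact Taylor expansion of a quadratic polynomial whose gradient at [t] is [- nGamma S mu t]. *)
Lemma gamma_chord (K : realType) (S : 'M[K]_2) (mu t w : 'cV[K]_2) (s : K) :
  sym_posdef S ->
  gamma S mu (t + s *: w) = gamma S mu t
    - s * dot (nGamma S mu t) w - s ^+ 2 / 2 * dot w (S *m w).
Proof.
move=> hS; have A0 k : (t + s *: w) k 0 = t k 0 + s * w k 0 by rewrite !mxE.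
have N k : nGamma S mu t k 0 = (S *m t) k 0 + mu k 0 by rewrite mxE.
rewrite /gamma !(quad_form2 _ _ 0 _ hS) !(dotE _ 0) !N !(mulmx2E _ 0) !A0.
by rewrite (sym_entry _ _ (rev_ord 0) 0 hS); field.
Qed.

(* Completing the square in the (3-i)-th coordinate. *)
Lemma bdGamma_square (K : realType) (S : 'M[K]_2) (i : 'I_2)
    (mu t : 'cV[K]_2) :
  sym_posdef S -> bdGamma S mu t ->
  nGamma S mu t (rev_ord i) 0 ^+ 2 =
  mu (rev_ord i) 0 ^+ 2
  - (S i i * S (rev_ord i) (rev_ord i) - S i (rev_ord i) ^+ 2) * t i 0 ^+ 2
  - 2 * (S (rev_ord i) (rev_ord i) * mu i 0
         - S i (rev_ord i) * mu (rev_ord i) 0) * t i 0.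
Proof.
move=> hS; rewrite /bdGamma /= /gamma (quad_form2 _ _ i _ hS) (dotE _ i) => g0.
rewrite [nGamma _ _ _ _ _]mxE (mulmx2E _ i) (sym_entry _ _ (rev_ord i) i hS).
apply/eqP; rewrite -subr_eq0; apply/eqP.
(* The factor [0] stands for [gamma S mu t]. *)
transitivity (-2 * S (rev_ord i) (rev_ord i) * 0 : K); last by ring.
by rewrite -g0; field.
Qed.

Lemma bdGamma_normal_dot (K : realType) (S : 'M[K]_2) (mu t : 'cV[K]_2) :
  bdGamma S mu t -> dot (nGamma S mu t) t = - dot mu t.
Proof.
move=> g0; have : dot (nGamma S mu t) t = dot t (S *m t) + dot mu t.
  by rewrite !(dotE _ 0) ![nGamma _ _ _ _ _]mxE; ring.
move: g0; rewrite /bdGamma /= /gamma => g0 ->; lra.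
Qed.

(* If a_j <> 0, the chord through t in the direction w = (1, d) with
   <n(t), w> = -1 ends at a point of the ellipse with a larger coordinate. *)
Lemma max_normal (K : realType) (S : 'M[K]_2) (i : 'I_2) (mu t : 'cV[K]_2) :
  sym_posdef S -> bdGamma S mu t ->
  (forall eta, bdGamma S mu eta -> eta i 0 <= t i 0) ->
  nGamma S mu t (rev_ord i) 0 = 0.
Proof.
move=> hS g0 tmax; set a := nGamma S mu t; set j := rev_ord i.
apply/eqP/negPn/negP => aj0.
pose w := 1 *: evec K i + (- ((a i 0 + 1) / a j 0)) *: evec K j.
have wi : w i 0 = 1 := evec_comb _ _ _ _.
have wj : w j 0 = - ((a i 0 + 1) / a j 0) := evec_comb_rev _ _ _ _.
have w0 : w != 0.
  by apply/eqP => /matrixP /(_ i 0); rewrite wi mxE; apply/eqP/oner_neq0.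
have aw : dot a w = -1 by rewrite (dotE _ i) wi wj; field.
have Q0 := hS.2 _ w0; set Q := dot w _ in Q0.
(* [2 / Q] is the nonzero root of [gamma S mu] along the chord. *)
have : bdGamma S mu (t + (2 / Q) *: w).
  rewrite /bdGamma /= gamma_chord // -/a aw -/Q g0.
  by field; rewrite gt_eqF.
move/tmax; rewrite mxE [X in _ + X]mxE wi mulr1 gerDl leNgt.
by rewrite divr_gt0.
Qed.

(** By [bdGamma_square], the squared other coordinate of the normal is a concave quadratic in the
    [i]-th coordinate of the point. It vanishes at [t i 0] and decreases there, since the [i]-th
    coordinate of the normal is positive. Beyond [t i 0] it is negative, so the ellipse has no point
    there. *)
Lemma theta_max_normal (K : realType) (S : 'M[K]_2) (i : 'I_2)
    (mu t : 'cV[K]_2) :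
  sym_posdef S -> bdGamma S mu t ->
  nGamma S mu t (rev_ord i) 0 = 0 -> 0 < nGamma S mu t i 0 ->
  theta_max S mu i = t.
Proof.
move=> hS g0 aj0 ai0; set j := rev_ord i in aj0 *.
have C0 := posdef_diag _ _ j hS; have D0 := posdef_minor _ _ i hS.
have qt := bdGamma_square _ _ i _ _ hS g0; rewrite -/j aj0 expr0n /= in qt.
rewrite -/j in D0.
(* The left side is minus half the slope of the quadratic at [t i 0]. *)
have aiE : (S i i * S j j - S i j ^+ 2) * t i 0
    + (S j j * mu i 0 - S i j * mu j 0) = S j j * nGamma S mu t i 0.
  transitivity (S j j * nGamma S mu t i 0 - S i j * nGamma S mu t j 0).
    rewrite ![nGamma _ _ _ _ _]mxE !(mulmx2E _ i) -/j (sym_entry _ _ j i hS).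
    ring.
  by rewrite aj0 mulr0 subr0.
have P0 : 0 < S j j * nGamma S mu t i 0 by rewrite mulr_gt0.
have tmax eta : bdGamma S mu eta -> eta i 0 <= t i 0.
  move=> /(bdGamma_square _ _ i _ _ hS); rewrite -/j.
  have := sqr_ge0 (nGamma S mu eta j 0); rewrite leNgt => + qe.
  apply: contraNle => lt; rewrite qe.
  move: aiE qt D0 P0 lt; set D := _ - _ ^+ 2; set p := _ * mu i 0 - _.
  set P := _ * nGamma _ _ _ _ _; move: (t i 0) (eta i 0) => x y aiE qt D0 P0 lt.
  have z0 : 0 < y - x by rewrite subr_gt0.
  have -> : mu j 0 ^+ 2 - D * y ^+ 2 - 2 * p * y
     = - ((y - x) * (D * (y - x) + 2 * P)).
    apply/eqP; rewrite -subr_eq0 [X in _ == X]qt -aiE; apply/eqP; ring.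
  by rewrite oppr_lt0 mulr_gt0 // addr_gt0 // mulr_gt0.
apply: xget_unique; first by split.
move=> u [gu umax]; apply: (cV2_ext _ i).
  by apply/eqP; rewrite eq_le tmax // umax.
have xe : u i 0 = t i 0 by apply/eqP; rewrite eq_le tmax // umax.
(* The [j]-th coordinate of the normal vanishes at both maximizers, which determines their [j]-th
   coordinate. *)
have := max_normal _ _ i _ _ hS gu umax; move: aj0.
rewrite ![nGamma _ _ _ _ _]mxE !(mulmx2E _ i) xe -/j => <- /addIr /addrI.
by apply: mulfI; rewrite gt_eqF.
Qed.

(** * The points [theta_r] and [theta_tilde] *)

Lemma theta_rP (K : realType) (S : 'M[K]_2) (mu : 'cV[K]_2) (R : 'M[K]_2)
    (i : 'I_2) :
  sym_posdef S -> 0 < R (rev_ord i) (rev_ord i) ->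
  R (rev_ord i) (rev_ord i) * mu i 0 - R i (rev_ord i) * mu (rev_ord i) 0 < 0 ->
  [/\ bdGamma S mu (theta_r S mu R i), theta_r S mu R i != 0 &
      0 < theta_r S mu R i i 0].
Proof.
move=> hS; set j := rev_ord i => r0 h.
have gE x : gammai R j x = R i j * x i 0 + R j j * x j 0.
  by rewrite /gammai (dotE _ i) !mxE.
(* [v] spans the line where [gammai R j] vanishes; the hypothesis on [mu] says [dot mu v < 0]. *)
pose v := R j j *: evec K i + (- R i j) *: evec K j.
have vi : v i 0 = R j j := evec_comb _ _ _ _.
have vj : v j 0 = - R i j := evec_comb_rev _ _ _ _.
have v0 : v != 0.
  by apply/eqP => /matrixP /(_ i 0); rewrite vi mxE => e; rewrite e ltxx in r0.
have muv : dot mu v < 0 by rewrite (dotE _ i) -/j vi vj; lra.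
have Q0 := hS.2 _ v0; set Q := dot v _ in Q0.
have [] : [/\ bdGamma S mu (theta_r S mu R i), theta_r S mu R i != 0 &
    gammai R j (theta_r S mu R i) = 0].
  (* The nonzero root of [gamma S mu] along the line spanned by [v]. *)
  pose k := - (2 * dot mu v / Q).
  have k0 : k != 0.
    by rewrite oppr_eq0 !mulf_neq0 ?invr_eq0 ?pnatr_eq0 ?(lt_eqF muv) ?(gt_eqF Q0).
  apply: (@xgetPex _ 0 [set theta | [/\ bdGamma S mu theta, theta != 0 &
    gammai R (rev_ord i) theta = 0]]%classic); exists (k *: v); split.
  - rewrite /bdGamma /= -[k *: v]add0r gamma_chord // -/Q.
    rewrite /nGamma mulmx0 add0r /gamma mulmx0.
    have -> : dot 0 (0 : 'cV[K]_2) = 0 by rewrite (dotE _ 0) !mxE; ring.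
    have -> : dot mu (0 : 'cV[K]_2) = 0 by rewrite (dotE _ 0) !mxE; ring.
    by rewrite /k; field; rewrite gt_eqF.
  - by rewrite scaler_eq0 negb_or k0.
  - by rewrite gE mxE vi mxE vj; ring.
set t := theta_r _ _ _ _ => g0 t0; rewrite gE => rt; split => //.
(* On the ellipse this is half of [dot t (S *m t)]; as [t] is a multiple of [v], it decides the sign
   of [t i 0]. *)
have : 0 < - dot mu t.
  by have := hS.2 _ t0; move: g0; rewrite /bdGamma /= /gamma; lra.
have -> : - dot mu t = t i 0 * (- dot mu v / R j j).
  rewrite !(dotE _ i) -/j vi vj.
  have -> : t j 0 = - R i j * t i 0 / R j j.
    apply: (mulfI (lt0r_neq0 r0));
      rewrite mulrC [RHS]mulrC divfK ?gt_eqF //; lra.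
  by field; rewrite gt_eqF.
by rewrite pmulr_lgt0 // divr_gt0 // oppr_gt0.
Qed.

Lemma theta_tildeE (K : realType) (S : 'M[K]_2) (mu : 'cV[K]_2) (R : 'M[K]_2)
    (i : 'I_2) :
  sym_posdef S -> 0 < R (rev_ord i) (rev_ord i) ->
  R (rev_ord i) (rev_ord i) * mu i 0 - R i (rev_ord i) * mu (rev_ord i) 0 < 0 ->
  theta_tilde S mu R i = theta_r S mu R i
    - (2 * nGamma S mu (theta_r S mu R i) (rev_ord i) 0
       / S (rev_ord i) (rev_ord i)) *: evec K (rev_ord i).
Proof.
move=> hS r0 h; have [g0 t0 ti0] := theta_rP _ _ _ _ _ hS r0 h.
rewrite /theta_tilde /=; set t := theta_r _ _ _ _ in g0 t0 ti0 *.
set j := rev_ord i; set a := nGamma S mu t.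
have C0 : S j j != 0 by rewrite gt_eqF ?posdef_diag.
case: ifPn => [/eqP tE|tN].
  rewrite -tE (_ : a j 0 = 0) ?mulr0 ?mul0r ?scale0r ?subr0 //.
  (* If no maximizer existed, [xget] would return its default [0], which [t0] excludes. *)
  move: tE; rewrite /theta_max; case: xgetP => [y -> [gy ymax] ty|_ /eqP].
    by apply: max_normal => //; rewrite ty.
  by rewrite (negPf t0).
have aj0 : a j 0 != 0.
  apply: contraNneq tN => aj0; apply/eqP/esym/theta_max_normal => //.
  have : 0 < dot a t.
    rewrite bdGamma_normal_dot //; have := hS.2 _ t0.
    by move: g0; rewrite /bdGamma /= /gamma; lra.
  by rewrite (dotE _ i) aj0 mul0r addr0 pmulr_lgt0.
set s := 2 * a j 0 / S j j.
have ti : (t - s *: evec K j) i 0 = t i 0.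
  by rewrite mxE [X in _ + X]mxE [X in - X]mxE evec_rev mulr0 subr0.
have tj : (t - s *: evec K j) j 0 = t j 0 - s.
  by rewrite mxE [X in _ + X]mxE [X in - X]mxE evec_self mulr1.
apply: xget_unique.
  split=> //; last first.
    by rewrite tj -subr_eq0 addrAC subrr sub0r oppr_eq0
      !mulf_neq0 ?invr_eq0 ?pnatr_eq0.
  rewrite /bdGamma /= -scaleNr gamma_chord // g0 dot_evec -/a.
  by rewrite (dotE _ j) evec_self evec_rev' mul_evec /s; field.
move=> u [gu ui uj]; apply: (cV2_ext _ i); rewrite ?ti ?tj //.
(* Equal [i]-th coordinates force the [j]-th coordinates of the normals at [u] and [t] to be equal
   or opposite; equality would give [u j 0 = t j 0]. *)
have := bdGamma_square _ _ i _ _ hS gu.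
rewrite ui -(bdGamma_square _ _ i _ _ hS g0) -/j -/a => /eqP.
have aE : a j 0 = S j i * t i 0 + S j j * t j 0 + mu j 0.
  by rewrite [a j 0]mxE (mulmx2E _ i).
have uE : nGamma S mu u j 0 = S j i * t i 0 + S j j * u j 0 + mu j 0.
  by rewrite [nGamma _ _ _ _ _]mxE (mulmx2E _ i) ui.
rewrite eqf_sqr => /orP[] /eqP e.
  case/negP: uj; apply/eqP/(mulfI C0).
  by move: e; rewrite uE aE => /addIr /addrI.
apply: (mulfI C0); rewrite mulrBr /s [X in _ - X]mulrC divfK //; lra.
Qed.

(** [nGamma] is affine with linear part [S], so moving the point along [evec K (rev_ord i)] moves
    the normal along its image under [S]. *)
Lemma face_symmetry_theta_r (K : realType) (S : 'M[K]_2) (mu : 'cV[K]_2)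
    (R : 'M[K]_2) (i : 'I_2) :
  sym_posdef S -> 0 < R (rev_ord i) (rev_ord i) ->
  R (rev_ord i) (rev_ord i) * mu i 0 - R i (rev_ord i) * mu (rev_ord i) 0 < 0 ->
  face_symmetry S (rev_ord i) (nGamma S mu (theta_r S mu R i)) =
  nGamma S mu (theta_tilde S mu R i).
Proof.
move=> hS r0 h; rewrite theta_tildeE // face_symmetryE //.
by rewrite [in RHS]/nGamma mulmxBr -scalemxAr addrAC.
Qed.

Theorem mainTheorem6 (K : realType) (Sigma : 'M[K]_2) (mu : 'cV[K]_2)
    (R : 'M[K]_2)
    (hSigma : sym_posdef Sigma)
    (hr11 : 0 < R 0 0) (hr22 : 0 < R 1 1)
    (hdet : 0 < R 0 0 * R 1 1 - R 0 1 * R 1 0)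
    (hmu1 : R 1 1 * mu 0 0 - R 0 1 * mu 1 0 < 0)
    (hmu2 : R 0 0 * mu 1 0 - R 1 0 * mu 0 0 < 0) :
  exit_velocity_tilde Sigma mu R 0 = nGamma Sigma mu (theta_tilde Sigma mu R 1)
  /\
  exit_velocity_tilde Sigma mu R 1 = nGamma Sigma mu (theta_tilde Sigma mu R 0).
Proof.
have rev0 : rev_ord 0 = 1 :> 'I_2 by apply/val_inj.
have rev1 : rev_ord 1 = 0 :> 'I_2 by apply/val_inj.
rewrite /exit_velocity_tilde /exit_velocity rev0 rev1; split.
- by have := face_symmetry_theta_r _ Sigma mu R 1; rewrite rev1; apply.
- by have := face_symmetry_theta_r _ Sigma mu R 0; rewrite rev0; apply.
Qed.
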